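(* Let $G$ be a finite group, let $0\le\alpha<1$, and let $W$ be an $\alpha$-semi-uniform random variable on $G$. Let $\mathcal P_0$ be an arbitrary $G$-valued random variable. Let $E_0,E_1,E_2,\ldots$ be independent, uniform random variables on $\{0,1\}$. For all $i\ge0$, define $\mathcal P_{i+1}=\mathcal P_i g_i^{E_i}$, where $g_i\in G$ is drawn from the distribution of $W$. Let $\gamma=14/(11+3\alpha)$ and let $\lambda>1$. Then for every integer $t\ge 2\log_\gamma|G|+\log_\gamma(64\lambda)$, with probability at least $1-1/\lambda$, $$\Pr(\mathcal P_t=g)\le\frac{15}{8}\cdot\frac1{|G|}\quad\text{for all } g\in G.$$ Hence $W\mathcal P_t$ is a $\max(\alpha,7/8)$-uniform random variable with probability at least $1-1/\lambda$.
   Context: A random variable $X$ on $G$ is $\varepsilon$-semi-uniform if $\Pr(X=g)\ge 1/|G|-\varepsilon/|G|$ for all $g\in G$, and $\varepsilon$-uniform if $|\Pr(X=g)-1/|G||\le\varepsilon/|G|$ for all $g\in G$. The elements $g_0,g_1,\ldots$ are drawn independently from the distribution of $W$ and then regarded as fixed; ''with probability at least $1-1/\lambda$'' refers to the choice of $g_0,\ldots,g_{t-1}$. For fixed $g_0,\ldots,g_{t-1}$, $\mathcal P_t=\mathcal P_0g_0^{E_0}\cdots g_{t-1}^{E_{t-1}}$ is a $G$-valued random variable whose distribution is that induced by $\mathcal P_0$ and the $E_i$, where the $E_i$ are independent of $\mathcal P_0$ and of the choice of the $g_i$. In the product $W\mathcal P_t$, $W$ is independent of $\mathcal P_t$. 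*)

(* Defs.v *)
From HB Require Import structures.
From mathcomp Require Import all_boot all_order all_algebra all_fingroup finmap.
From mathcomp Require Import all_classical all_reals all_analysis.

Set Implicit Arguments.
Unset Strict Implicit.
Unset Printing Implicit Defensive.

Import Order.TTheory GRing.Theory Num.Theory.

Local Open Scope fset_scope.
Local Open Scope classical_set_scope.
Local Open Scope ring_scope.

(* Logarithm of x in base b. *)
Definition logb {R : realType} (b x : R) : R := ln x / ln b.

(* The group G as a measurable space in which every subset is measurable; the
   base point that measurableType requires is the identity. *)
Definition discr (G : finGroupType) : Type := G.

HB.instance Definition _ (G : finGroupType) := FinGroup.copy (discr G) G.
HB.instance Definition _ (G : finGroupType) :=
  isPointed.Build (discr G) (1%g : G).
HB.instance Definition _ (G : finGroupType) :=
  @isMeasurable.Build default_measure_display (discr G) discrete_measurable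
    discrete_measurable0 discrete_measurableC discrete_measurableU.

Definition Pr {d : measure_display} {T : measurableType d} {R : realType}
  (P : probability T R) (A : set T) : R := fine (P A).

(* Mutual independence of a family (F i)_i of sigma-algebras on T. *)
Definition mutually_independent {d : measure_display} {T : measurableType d}
    {R : realType} (P : probability T R) {I : choiceType}
    (F : I -> set (set T)) : Prop :=
  forall (J : {fset I}) (A : I -> set T),
    (forall i, i \in J -> F i (A i)) ->
    Pr P (\bigcap_(i in [set` J]) A i) = \prod_(i <- J) Pr P (A i).

(* g_sigma_algebra_preimage X is the sigma-algebra generated by X. *)
Definition independent_RV {d d1 d2 : measure_display} {T : measurableType d}
    {T1 : measurableType d1} {T2 : measurableType d2}
    {R : realType} (P : probability T R)
    (X : {RV P >-> T1}) (Y : {RV P >-> T2}) : Prop :=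
  forall A B : set T,
    g_sigma_algebra_preimage X A -> g_sigma_algebra_preimage Y B ->
    Pr P (A `&` B) = Pr P A * Pr P B.

(* X has the same distribution as Y; the sample spaces may differ. *)
Definition same_distribution {d d' d1 : measure_display}
    {T : measurableType d} {T' : measurableType d'} {T1 : measurableType d1}
    {R : realType} (P : probability T R) (P' : probability T' R)
    (X : {RV P >-> T1}) (Y : {RV P' >-> T1}) : Prop :=
  forall A : set T1, measurable A -> distribution P X A = distribution P' Y A.

Definition semi_uniform {d : measure_display} {T : measurableType d}
    {R : realType} (P : probability T R) {G : finGroupType}
    (eps : R) (X : {RV P >-> discr G}) : Prop :=
  forall x : G, Pr P (X @^-1` [set x]) >= 1 / #|G|%:R - eps / #|G|%:R.

Definition eps_uniform {d : measure_display} {T : measurableType d}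
    {R : realType} (P : probability T R) {G : finGroupType}
    (eps : R) (X : {RV P >-> discr G}) : Prop :=
  forall x : G, `|Pr P (X @^-1` [set x]) - 1 / #|G|%:R| <= eps / #|G|%:R.

Arguments independent_RV {d d1 d2 T T1 T2 R} P X Y.
Arguments same_distribution {d d' d1 T T' T1 R} P P' X Y.
Arguments semi_uniform {d T R} P {G} eps X.
Arguments eps_uniform {d T R} P {G} eps X.

Section GroupValued.
Context {d : measure_display} {T : measurableType d} {G : finGroupType}.
Implicit Types (X Y : {mfun T >-> discr G}) (E : {mfun T >-> bool}).

Definition mul_RV X Y : T -> discr G := fun w => (X w * Y w)%g.

Fact measurable_mul_RV X Y : measurable_fun [set: T] (mul_RV X Y).
Proof.
move=> _ A _; rewrite setTI.
have -> : mul_RV X Y @^-1` A = \bigcup_(x in [set: discr G])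
    \bigcup_(y in [set y | A (x * y)%g]) (X @^-1` [set x] `&` Y @^-1` [set y]).
  apply/seteqP; split=> [w Aw|w [x _ [y Ay [/= Xw Yw]]]].
    by exists (X w) => //; exists (Y w).
  by rewrite /= /mul_RV Xw Yw.
apply: fin_bigcup_measurable => [|x _]; first exact: finite_finset.
apply: fin_bigcup_measurable => [|y _]; first exact: finite_finset.
by apply: measurableI; rewrite -[X in measurable X]setTI;
  apply: measurable_funPT.
Qed.

HB.instance Definition _ X Y :=
  isMeasurableFun.Build _ _ _ _ (mul_RV X Y) (measurable_mul_RV X Y).

(* x ^ E with x fixed and E valued in {0, 1}, encoded by false and true. *)
Definition exp_RV (x : G) E : T -> discr G := fun w => (x ^+ E w)%g.

Fact measurable_exp_RV (x : G) E :
  measurable_fun [set: T] (exp_RV x E).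
Proof.
move=> _ A _; rewrite setTI.
have -> : exp_RV x E @^-1` A = E @^-1` [set b : bool | A (x ^+ b)%g] by [].
by rewrite -[X in measurable X]setTI; apply: measurable_funPT.
Qed.

HB.instance Definition _ (x : G) E :=
  isMeasurableFun.Build _ _ _ _ (exp_RV x E) (measurable_exp_RV x E).

Fixpoint walk (P0 : {mfun T >-> discr G}) (E : nat -> {mfun T >-> bool})
    (g : nat -> G) (i : nat) : {mfun T >-> discr G} :=
  if i is i'.+1 then mul_RV (walk P0 E g i') (exp_RV (g i') (E i')) else P0.

End GroupValued.

(* Main.v *)
(** The energy of the walk after k steps is the squared L2-distance
    N_k = sum_x (Pr(P_k = x) - 1/|G|)^2.  A step by g replaces the deviation
    f from uniform by x |-> (f(x) + f(x g^-1)) / 2, so N_{k+1} is half of N_k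
    plus half of the autocorrelation of f at g.  The autocorrelations are at
    most N_k and add up to 0, hence averaging over an alpha-semi-uniform g gives
    E N_{k+1} <= (1 + alpha)/2 N_k <= N_k / gamma.  As N_0 <= 1, Markov's
    inequality makes N_t < (7/8)^2 / |G|^2 likely, which bounds each
    deviation by (7/8) / |G|. *)
Require Import Defs.
From HB Require Import structures.
From mathcomp Require Import all_boot all_order all_algebra all_fingroup finmap.
From mathcomp Require Import all_classical all_reals all_analysis.
From mathcomp Require Import ring lra.

Set Implicit Arguments.
Unset Strict Implicit.
Unset Printing Implicit Defensive.

Import Order.TTheory GRing.Theory Num.Theory.

Local Open Scope classical_set_scope.
Local Open Scope ring_scope.

(** * Probabilities as real numbers, and the law of total probability *)

Section Pr.
Context {d : measure_display} {T : measurableType d} {R : realType}.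
Variable P : probability T R.

Lemma Pr_ge0 A : 0 <= Pr P A.
Proof. exact: fine_ge0. Qed.

Lemma Pr_EFin A : measurable A -> P A = (Pr P A)%:E.
Proof. by move=> mA; rewrite /Pr fineK ?fin_num_measure. Qed.

Lemma le_Pr A B : measurable A -> measurable B -> A `<=` B -> Pr P A <= Pr P B.
Proof.
by move=> mA mB AB; rewrite -lee_fin -!Pr_EFin // le_measure ?inE.
Qed.

Lemma Pr_setT : Pr P setT = 1.
Proof. by rewrite /Pr probability_setT. Qed.

Lemma Pr_le1 A : measurable A -> Pr P A <= 1.
Proof. by move=> mA; rewrite -Pr_setT le_Pr. Qed.

Lemma Pr_setC A : measurable A -> Pr P (~` A) = 1 - Pr P A.
Proof.
move=> mA; apply: EFin_inj.
by rewrite EFinB -!Pr_EFin ?probability_setC //; exact: measurableC.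
Qed.

(** The fibres of [X] cut [A] into finitely many disjoint measurable pieces, so additivity applies;
    [A] is measurable as their union. *)
Lemma Pr_total (I : finType) (X : T -> I) A :
  (forall i, measurable (A `&` X @^-1` [set i])) ->
  Pr P A = \sum_i Pr P (A `&` X @^-1` [set i]).
Proof.
move=> mAX; apply: EFin_inj; rewrite -sumEFin.
have AE : A = \bigcup_(i in [set: I]) (A `&` X @^-1` [set i]).
  by apply/seteqP; split=> [w Aw|w [i _ []//]]; exists (X w).
rewrite -Pr_EFin; last first.
  by rewrite AE; apply: fin_bigcup_measurable => //; exact: finite_finset.
rewrite [in LHS]AE measure_fin_bigcup //; first last.
- by move=> i j _ _ [w [[_ <-] [_ <-]]].
- exact: finite_finset.
rewrite (fsbig_fwiden (index_enum I)) ?index_enum_uniq //; first last.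
- by move=> i [_ []].
- by move=> i _ /=; rewrite mem_index_enum.
by apply: eq_bigr => i _; exact: Pr_EFin.
Qed.

Lemma measurable_fiber (G : finGroupType) (X : {mfun T >-> discr G}) A :
  measurable (X @^-1` A).
Proof. by rewrite -[X in measurable X]setTI; apply: measurable_funPT. Qed.

Lemma Pr_fiber_total (G : finGroupType) (X : {mfun T >-> discr G}) A :
  measurable A -> Pr P A = \sum_(x : G) Pr P (A `&` X @^-1` [set x]).
Proof.
move=> mA; apply: Pr_total => x; apply: measurableI => //.
exact: measurable_fiber.
Qed.

Lemma sum_Pr_fiber (G : finGroupType) (X : {mfun T >-> discr G}) :
  \sum_(x : G) Pr P (X @^-1` [set x]) = 1.
Proof.
rewrite -Pr_setT (Pr_fiber_total X) //.
by apply: eq_bigr => x _; rewrite setTI.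
Qed.

Lemma Pr_independent_seq (I : choiceType) (F : I -> set (set T))
    (s : seq I) (A : I -> set T) :
  mutually_independent P F -> uniq s -> (forall i, F i (A i)) ->
  Pr P [set w | forall i, i \in s -> A i w] = \prod_(i <- s) Pr P (A i).
Proof.
move=> indF us FA.
transitivity (Pr P (\bigcap_(i in [set` [fset i in s]%fset]) A i)).
  congr (Pr P _); apply/seteqP; split=> w Aw i; last first.
    by move=> si; apply: Aw; rewrite /= in_fset.
  by rewrite /= in_fset; apply: Aw.
rewrite indF //; apply: perm_big; apply: uniq_perm => // i.
by rewrite in_fset.
Qed.

End Pr.

(** * Autocorrelations on a finite group and the contraction of the energy *)

Section Energy.
Context {R : realFieldType} {G : finGroupType}.
Implicit Types (f w : G -> R).

Lemma cardG_neq0 : #|G|%:R != 0 :> R.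
Proof. by rewrite pnatr_eq0 -lt0n -cardsT cardG_gt0. Qed.

Lemma sum_shift f a : \sum_x f (x * a)%g = \sum_x f x.
Proof. by rewrite [RHS](reindex_inj (mulIg a)). Qed.

(** For fixed [x], the element [x * a^-1] runs over the whole group as [a] does, so the double sum
    factors. *)
Lemma sum_autocorrelation f :
  \sum_a \sum_x f x * f (x * a^-1)%g = (\sum_x f x) ^+ 2.
Proof.
rewrite exchange_big expr2 mulr_suml; apply: eq_bigr => x _ /=.
rewrite -mulr_sumr; congr (_ * _).
by rewrite [RHS](reindex_inj (mulgI x)) [RHS](reindex_inj invg_inj).
Qed.

(** Termwise 2uv <= u^2 + v^2; the squares of the translate have the same sum as those of [f]. *)
Lemma autocorrelation_le f a :
  \sum_x f x * f (x * a)%g <= \sum_x f x ^+ 2.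
Proof.
rewrite -(ler_pM2l (ltr0n R 2)).
rewrite [leRHS]mulr_natl [leRHS]mulr2n -{2}(sum_shift (fun x => f x ^+ 2) a).
rewrite -big_split mulr_sumr /=; apply: ler_sum => x _.
by have := sqr_ge0 (f x - f (x * a)%g); lra.
Qed.

(* Splitting off the uniform part (1 - alpha) / #|G| of w leaves mass alpha;
   the uniform part averages the autocorrelations of f to 0. *)
Lemma energy_contraction f w alpha :
  (forall a, (1 - alpha) / #|G|%:R <= w a) -> \sum_a w a = 1 ->
  \sum_x f x = 0 ->
  \sum_a w a * (\sum_x ((f x + f (x * a^-1)%g) / 2) ^+ 2)
    <= (1 + alpha) / 2 * \sum_x f x ^+ 2.
Proof.
move=> wge w1 f0; set S := \sum_x f x ^+ 2.
pose c a := \sum_x f x * f (x * a^-1)%g.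
have sqE a : \sum_x ((f x + f (x * a^-1)%g) / 2) ^+ 2 = (S + c a) / 2.
  transitivity ((S + S + 2 * c a) / 4); last by lra.
  rewrite -{2}[S](sum_shift (fun x => f x ^+ 2) a^-1) /c mulr_sumr.
  rewrite -!big_split /=.
  by rewrite mulr_suml; apply: eq_bigr => x _; field.
have cw : \sum_a w a * c a <= alpha * S.
  have -> : \sum_a w a * c a = \sum_a (w a - (1 - alpha) / #|G|%:R) * c a.
    under [RHS]eq_bigr do rewrite mulrBl.
    rewrite big_split /= sumrN -mulr_sumr sum_autocorrelation f0.
    by rewrite expr0n /= mulr0 subr0.
  apply: (@le_trans _ _ (\sum_a (w a - (1 - alpha) / #|G|%:R) * S)).
    apply: ler_sum => a _; rewrite ler_wpM2l ?subr_ge0 //.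
    exact: autocorrelation_le.
  rewrite -mulr_suml big_split /= w1 sumrN sumr_const -[_ *+ _]mulr_natr.
  by rewrite divfK ?cardG_neq0 //; lra.
under eq_bigr do rewrite sqE mulrA mulrDr.
by rewrite -mulr_suml big_split /= -mulr_suml w1; lra.
Qed.

End Energy.

(** * Events about the first draws, and Markov's inequality along the tree of histories *)

Section Cylinder.
Context {d : measure_display} {S : measurableType d} {R : realType}.
Context {Q : probability S R} {G : finGroupType}.
Variable g : nat -> {RV Q >-> discr G}.
Implicit Types (h : nat -> G) (B : set (nat -> G)).

Definition update h k (x : G) : nat -> G := fun i => if i == k then x else h i.

Definition cylinder h k : set S := [set s | forall i, (i < k)%N -> g i s = h i].

(** Histories are infinite sequences so that they can be fed to [walk]; this condition cuts an event
    down to the first [t] levels of the tree. *)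
Definition determined_before t B : Prop := forall h h',
  (forall i, (i < t)%N -> h i = h' i) -> B h -> B h'.

Lemma cylinder0 h : cylinder h 0 = setT.
Proof. by apply/seteqP; split. Qed.

Lemma cylinder_update h k x :
  cylinder (update h k x) k.+1 = cylinder h k `&` g k @^-1` [set x].
Proof.
apply/seteqP; split=> [s cs|s [cs /= gx] i].
  split; last by rewrite /= cs // /update eqxx.
  by move=> i ik; rewrite cs ?ltnS 1?ltnW // /update ltn_eqF.
by rewrite ltnS leq_eqVlt /update; case: eqP => [->|_ /cs].
Qed.

Lemma measurable_cylinder h k : measurable (cylinder h k).
Proof.
elim: k => [|k IH]; first by rewrite cylinder0.
suff -> : cylinder h k.+1 = cylinder h k `&` g k @^-1` [set h k].
  by apply: measurableI => //; exact: measurable_fiber.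
rewrite -cylinder_update; congr (cylinder _ _); apply/funext => i.
by rewrite /update; case: eqP => [->|].
Qed.

Lemma cylinderI_determined t B h : determined_before t B ->
  cylinder h t `&` [set s | B (fun i => g i s)] =
  if `[< B h >] then cylinder h t else set0.
Proof.
move=> Bt; case: asboolP => Bh; apply/seteqP; split=> s //.
- by case.
- by move=> cs; split=> //; apply: Bt Bh => i it; rewrite cs.
- by move=> [cs /= Bs]; apply: Bh; apply: Bt Bs => i it; rewrite cs.
Qed.

Lemma cylinderI_update (A : set S) h k x :
  (cylinder h k `&` A) `&` g k @^-1` [set x] =
  cylinder (update h k x) k.+1 `&` A.
Proof. by rewrite cylinder_update setIAC. Qed.

(** On a cylinder of length [t] the event is all or nothing, and each shorter cylinder is the finite
    union of its one-step extensions. *)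
Lemma measurable_determined t B : determined_before t B ->
  measurable [set s | B (fun i => g i s)].
Proof.
move=> Bt; set A := [set s | _].
suff mA m : forall h k, (k + m)%N = t -> measurable (cylinder h k `&` A).
  by have := mA t (fun=> 1%g) 0%N erefl; rewrite cylinder0 setTI.
elim: m => [|m IH] h k.
  rewrite addn0 => ->; rewrite cylinderI_determined //.
  by case: ifP => _; [exact: measurable_cylinder|exact: measurable0].
rewrite addnS -addSn => kmt.
have -> : cylinder h k `&` A =
    \bigcup_(x in [set: G]) (cylinder (update h k x) k.+1 `&` A).
  apply/seteqP; split=> [s As|s [x _]]; last first.
    by rewrite -cylinderI_update => -[].
  by exists (g k s) => //; rewrite -cylinderI_update.
by apply: fin_bigcup_measurable => [|x _]; [exact: finite_finset|exact: IH].
Qed.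

(* V is a supermartingale along the g_i, and B forces V t >= 1; this is
   Markov's inequality for V t, by backward induction on k. *)
Lemma Pr_le_supermartingale (w : G -> R) (V : nat -> (nat -> G) -> R) t B :
  (forall h k, Pr Q (cylinder h k) = \prod_(i < k) w (h i)) ->
  (forall h k, 0 <= V k h) ->
  (forall h k, (k < t)%N -> \sum_x w x * V k.+1 (update h k x) <= V k h) ->
  determined_before t B ->
  (forall h, B h -> 1 <= V t h) ->
  forall h, Pr Q [set s | B (fun i => g i s)] <= V 0 h.
Proof.
move=> Qw V0 Vsup Bt BV h0; set A := [set s | _].
have mA : measurable A by exact: (measurable_determined Bt).
(* This bounds the conditional probability of [A] given the first [k] draws by [V k h], without
   dividing by a cylinder probability that may vanish. The number of remaining draws is [m]. *)
suff leA m : forall h k, (k + m)%N = t ->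
    Pr Q (cylinder h k `&` A) <= Pr Q (cylinder h k) * V k h.
  by have := leA t h0 0%N erefl; rewrite cylinder0 setTI Pr_setT mul1r.
elim: m => [|m IH] h k.
  rewrite addn0 => ->; rewrite cylinderI_determined //; case: asboolP => [Bh|_].
    by rewrite ler_peMr ?Pr_ge0 ?BV.
  by rewrite /Pr measure0 mulr_ge0 ?fine_ge0.
rewrite addnS => kmt; have kt : (k < t)%N by rewrite -kmt ltnS leq_addr.
rewrite (Pr_fiber_total Q (g k)); last first.
  by apply: measurableI => //; exact: measurable_cylinder.
have step x : Pr Q (cylinder (update h k x) k.+1) = Pr Q (cylinder h k) * w x.
  rewrite !Qw big_ord_recr /= {2}/update eqxx; congr (_ * _).
  by apply: eq_bigr => i _; rewrite /update ltn_eqF.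
apply: le_trans (ler_wpM2l (Pr_ge0 Q _) (Vsup h k kt)).
rewrite mulr_sumr; apply: ler_sum => x _.
by rewrite cylinderI_update mulrA -step IH // addSn.
Qed.

Lemma Pr_cylinder h k :
  mutually_independent Q (fun i => g_sigma_algebra_preimage (g i)) ->
  Pr Q (cylinder h k) = \prod_(i < k) Pr Q (g i @^-1` [set h i]).
Proof.
move=> indg; rewrite -(big_mkord xpredT (fun i => Pr Q (g i @^-1` [set h i]))).
rewrite -(Pr_independent_seq (P := Q) (A := fun i => g i @^-1` [set h i]) indg).
- congr (Pr Q _); apply/seteqP; split=> s cs i.
    by rewrite mem_index_iota => /cs.
  by move=> ik; apply: cs; rewrite mem_index_iota.
- exact: iota_uniq.
- by move=> i; exists [set h i]; rewrite ?setTI.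
Qed.

End Cylinder.

(** * The law of the walk for fixed group elements, and its energy *)

Section Walk.
Context {d : measure_display} {T : measurableType d} {R : realType}.
Context {P : probability T R} {G : finGroupType}.
Variables (P0 : {RV P >-> discr G}) (E : nat -> {RV P >-> bool}).
Implicit Types (h : nat -> G) (b : nat -> bool).

Lemma walk_ext h h' k : (forall i, (i < k)%N -> h i = h' i) ->
  walk P0 E h k =1 walk P0 E h' k.
Proof.
elim: k => [//|k IH] hh' w /=.
rewrite /mul_RV /exp_RV hh' // IH // => i ik.
by apply: hh'; rewrite ltnS ltnW.
Qed.

Lemma walk_fiber_ext h h' k (A : set (discr G)) :
  (forall i, (i < k)%N -> h i = h' i) ->
  walk P0 E h k @^-1` A = walk P0 E h' k @^-1` A.
Proof. by move=> hh'; apply/seteqP; split=> w /=; rewrite (walk_ext hh'). Qed.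

Hypothesis E12 : forall i (c : bool), Pr P (E i @^-1` [set c]) = 1 / 2.
Hypothesis indE : mutually_independent P (fun o : option nat =>
  if o is Some i then g_sigma_algebra_preimage (E i)
  else g_sigma_algebra_preimage P0).

Lemma measurable_event i (c : bool) : measurable (E i @^-1` [set c]).
Proof. by rewrite -[X in measurable X]setTI; apply: measurable_funPT. Qed.

Definition coins b t k : set T :=
  [set w | forall i, (t <= i < t + k)%N -> E i w = b i].

(** Overriding [b] at [t] extends the window to the left by a toss with freely chosen outcome
    [c]. *)
Lemma coinsS b t k (c : bool) :
  coins (fun i => if i == t then c else b i) t k.+1 =
  E t @^-1` [set c] `&` coins b t.+1 k.
Proof.
apply/seteqP; split=> [w cw|w [/= Et cw] i].
  split; first by rewrite /= cw ?eqxx // leqnn addnS ltnS leq_addr.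
  move=> i /andP[ti ik]; rewrite cw ?gtn_eqF //.
  by rewrite ltnW //= addnS -addSn.
case: eqP => [->|/eqP it]; first by [].
by rewrite addnS -addSn leq_eqVlt eq_sym (negPf it) /= => /cw.
Qed.

Lemma coins0 b t : coins b t 0 = setT.
Proof.
apply/seteqP; split=> // w _ i.
by rewrite addn0 => /andP[ti]; rewrite ltnNge ti.
Qed.

Lemma measurable_coins b t k : measurable (coins b t k).
Proof.
elim: k t => [|k IH] t; first by rewrite coins0.
suff -> : coins b t k.+1 = E t @^-1` [set b t] `&` coins b t.+1 k.
  by apply: measurableI => //; exact: measurable_event.
rewrite -coinsS; congr coins; apply/funext => i.
by case: eqP => [->|].
Qed.

(** Once the toss is known, the last step is a right translation by a constant, which can be
    undone. *)
Lemma walkS_fiber h t x (c : bool) :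
  walk P0 E h t.+1 @^-1` [set x] `&` E t @^-1` [set c] =
  walk P0 E h t @^-1` [set (x * (h t ^+ c)^-1)%g] `&` E t @^-1` [set c].
Proof.
apply/seteqP; split=> w [/= wx Ec]; split=> //.
  by rewrite -wx /mul_RV /= /exp_RV Ec mulgK.
by rewrite /= /mul_RV /= /exp_RV wx Ec mulgKV.
Qed.

(* The future coins are carried along so that the induction closes. *)
Lemma Pr_walk_coins h t b k x :
  Pr P (walk P0 E h t @^-1` [set x] `&` coins b t k) =
  Pr P (walk P0 E h t @^-1` [set x]) * (1 / 2) ^+ k.
Proof.
elim: t => [|t IH] in b k x *.
  (* At time 0 the event is a conjunction over the joint family: [None] stands for the initial
     position, [Some i] for toss [i]. *)
  pose A o := if o is Some i then E i @^-1` [set b i] else P0 @^-1` [set x].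
  pose s := None :: [seq Some i | i <- iota 0 k].
  transitivity (Pr P [set w | forall o, o \in s -> A o w]).
    congr (Pr P _); apply/seteqP; split=> [w [wx cw] o|w sw].
      by rewrite inE => /predU1P[->//|/mapP[i]]; rewrite mem_iota => /cw + ->.
    split; first by apply: (sw None); rewrite mem_head.
    move=> i ik; apply: (sw (Some i)); rewrite inE /=.
    by rewrite map_f // mem_iota.
  rewrite (Pr_independent_seq indE); first last.
  - by case=> [i|]; [exists [set b i]|exists [set x]]; rewrite ?setTI.
  - by rewrite /s /= map_inj_uniq ?iota_uniq ?andbT;
      [apply/mapP => -[]|move=> ? ? []].
  rewrite big_cons big_map; congr (_ * _).
  under eq_bigr do rewrite E12.
  by rewrite big_const_seq count_predT size_iota iter_mulr_1.
have mW x' t' : measurable (walk P0 E h t' @^-1` [set x']).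
  exact: measurable_fiber.
(* Splitting on toss [t] adds it to the window, so the induction hypothesis is used with [k'.+1]
   tosses at time [t]. *)
have split_coin b' k' :
    Pr P (walk P0 E h t.+1 @^-1` [set x] `&` coins b' t.+1 k') =
    \sum_(c : bool) Pr P (walk P0 E h t @^-1` [set (x * (h t ^+ c)^-1)%g])
      * (1 / 2) ^+ k'.+1.
  rewrite (Pr_total P (X := E t)) => [|c].
    by apply: eq_bigr => c _; rewrite setIAC walkS_fiber -setIA -coinsS IH.
  apply: measurableI; last exact: measurable_event.
  by apply: measurableI => //; exact: measurable_coins.
(* The empty window, [k' = 0], evaluates the probability on the right by the same formula. *)
rewrite split_coin -[X in Pr P X * _]setIT -(coins0 b t.+1) split_coin.
by rewrite mulr_suml; apply: eq_bigr => c _; rewrite expr1 exprS mulrA.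
Qed.

Lemma Pr_walkS h t x :
  Pr P (walk P0 E h t.+1 @^-1` [set x]) =
  (Pr P (walk P0 E h t @^-1` [set x])
   + Pr P (walk P0 E h t @^-1` [set (x * (h t)^-1)%g])) / 2.
Proof.
rewrite (Pr_total P (X := E t)) => [|c]; last first.
  by apply: measurableI; [exact: measurable_fiber|exact: measurable_event].
rewrite big_bool /= !walkS_fiber expg1 expg0 invg1 mulg1.
have coinE c : E t @^-1` [set c] = coins (fun=> c) t 1.
  apply/seteqP; split=> w /= => [wc i|->//]; last by rewrite leqnn addn1 ltnSn.
  by rewrite addn1 ltnS -eqn_leq => /eqP <-.
by rewrite !coinE !Pr_walk_coins expr1; lra.
Qed.

Definition energy h k : R :=
  \sum_(x : G) (Pr P (walk P0 E h k @^-1` [set x]) - 1 / #|G|%:R) ^+ 2.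

Lemma energy_ge0 h k : 0 <= energy h k.
Proof. by apply: sumr_ge0 => x _; exact: sqr_ge0. Qed.

Lemma sum_deviation (X : {RV P >-> discr G}) :
  \sum_(x : G) (Pr P (X @^-1` [set x]) - 1 / #|G|%:R) = 0.
Proof.
rewrite big_split /= sum_Pr_fiber sumrN sumr_const -[_ *+ _]mulr_natr.
by rewrite divfK ?subrr ?cardG_neq0.
Qed.

Lemma energy0_le1 h : energy h 0 <= 1.
Proof.
(* With u = 1/|G| and q the probability of [x], the bound 1 is written as the sum of q - u(q - u).
   Termwise the claim is then q^2 - uq <= q. *)
rewrite -[leRHS]subr0 -[X in _ - X](mulr0 (1 / #|G|%:R)) -(sum_deviation P0).
rewrite -[X in _ <= X - _](sum_Pr_fiber P P0) mulr_sumr -sumrB.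
apply: ler_sum => x _.
set q := Pr P _; have q0 : 0 <= q by exact: Pr_ge0.
have q1 : q <= 1 by apply: Pr_le1; exact: measurable_fiber.
have n0 : 0 <= 1 / #|G|%:R :> R by rewrite divr_ge0.
rewrite /=; move: (1 / _) n0 => u u0; have := mulr_ge0 u0 q0.
by have := mulr_ge0 q0 (etrans (subr_ge0 q 1) q1); rewrite expr2 => *; nra.
Qed.

(** The uniform law is translation invariant, so by [Pr_walkS] the new deviation averages the old
    one and its translate by [a]; [energy_contraction] applies. *)
Lemma energy_step h k (w : G -> R) alpha :
  (forall a, (1 - alpha) / #|G|%:R <= w a) -> \sum_a w a = 1 ->
  \sum_a w a * energy (update h k a) k.+1 <= (1 + alpha) / 2 * energy h k.
Proof.
move=> wge w1.
have walkE a y :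
    walk P0 E (update h k a) k @^-1` [set y] = walk P0 E h k @^-1` [set y].
  by apply: walk_fiber_ext => i ik; rewrite /update ltn_eqF.
have := energy_contraction wge w1 (sum_deviation (walk P0 E h k)).
apply: le_trans; apply: ler_sum => a _.
rewrite [X in _ * X <= _](_ : _ = \sum_x
    ((Pr P (walk P0 E h k @^-1` [set x]) - 1 / #|G|%:R
      + (Pr P (walk P0 E h k @^-1` [set (x * a^-1)%g]) - 1 / #|G|%:R)) / 2)
    ^+ 2) //.
apply: eq_bigr => x _; rewrite Pr_walkS !walkE /update eqxx; congr (_ ^+ 2).
by field; exact: cardG_neq0.
Qed.

End Walk.

(** * Multiplication by an independent semi-uniform variable, and assembly of the theorem *)

Lemma mul_RV_eps_uniform (R : realType) (G : finGroupType)
    (d : measure_display) (T : measurableType d) (P : probability T R)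
    (alpha beta : R) (W X : {RV P >-> discr G}) :
  semi_uniform P alpha W -> independent_RV P W X ->
  (forall x : G, Pr P (X @^-1` [set x]) <= (1 + beta) * (1 / #|G|%:R)) ->
  eps_uniform P (Num.max alpha beta) (mul_RV W X).
Proof.
move=> semiW indWX Xle x; set n := #|G|%:R.
have n0 : 0 <= n^-1 :> R by rewrite invr_ge0.
have -> : Pr P (mul_RV W X @^-1` [set x]) = \sum_(a : G)
    Pr P (W @^-1` [set a]) * Pr P (X @^-1` [set (a^-1 * x)%g]).
  rewrite (Pr_fiber_total P W); last exact: measurable_fiber.
  apply: eq_bigr => a _; rewrite -indWX; last 2 first.
  - by exists [set a]; rewrite ?setTI.
  - by exists [set (a^-1 * x)%g]; rewrite ?setTI.
  congr (Pr P _); apply/seteqP; split=> w [/=].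
    by rewrite /mul_RV => <- ->; rewrite mulKg.
  by move=> Wa Xw; rewrite /mul_RV Wa Xw mulKVg.
set p := \sum_a _.
(* Upper bound: [p] averages values of the law of [X], with the law of [W] as weights. *)
have ple : p <= (1 + beta) / n.
  apply: (@le_trans _ _
      (\sum_(a : G) Pr P (W @^-1` [set a]) * ((1 + beta) / n))).
    apply: ler_sum => a _; rewrite ler_wpM2l ?Pr_ge0 //.
    by rewrite -[n^-1]mul1r Xle.
  by rewrite -mulr_suml sum_Pr_fiber mul1r.
(* Lower bound: the roles are exchanged, and the law of [X] supplies the weights, since [a^-1 * x]
   runs over the group. *)
have pge : (1 - alpha) / n <= p.
  have -> : (1 - alpha) / n = \sum_(a : G)
      (1 - alpha) / n * Pr P (X @^-1` [set (a^-1 * x)%g]).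
    rewrite -mulr_sumr -[LHS]mulr1 -(sum_Pr_fiber P X); congr (_ * _).
    by rewrite (reindex_inj (mulIg x)) (reindex_inj invg_inj).
  apply: ler_sum => a _; rewrite ler_wpM2r ?Pr_ge0 //.
  by have := semiW a; rewrite mulrBl.
have amax : alpha / n <= Num.max alpha beta / n.
  by rewrite ler_wpM2r ?le_max ?lexx.
have bmax : beta / n <= Num.max alpha beta / n.
  by rewrite ler_wpM2r ?le_max ?lexx ?orbT.
rewrite ler_norml; move: pge ple; rewrite mulrBl mulrDl => pge ple.
by apply/andP; split; lra.
Qed.

(* (1 + alpha) / 2 <= (11 + 3 alpha) / 14 = 1 / gamma on [0, 1]. *)
Lemma contraction_pow_le (R : realType) (alpha c x : R) (t : nat) :
  0 <= alpha -> alpha < 1 -> 0 < c -> 0 < x ->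
  let gamma := 14 / (11 + 3 * alpha) in
  2 * logb gamma x + logb gamma c <= t%:R ->
  ((1 + alpha) / 2) ^+ t <= (x ^+ 2 * c)^-1.
Proof.
move=> a0 a1 c0 x0 gamma tge.
have g1 : 1 < gamma by rewrite /gamma ltr_pdivlMr; lra.
have g0 : 0 < gamma by exact: lt_trans g1.
have lng : 0 < ln gamma by rewrite ln_gt0.
have xc0 : 0 < x ^+ 2 * c by rewrite mulr_gt0 ?exprn_gt0.
apply: (@le_trans _ _ (gamma^-1 ^+ t)).
  rewrite lerXn2r ?nnegrE ?invr_ge0 ?(ltW g0) //; first lra.
  by rewrite /gamma invf_div; lra.
rewrite exprVn lef_pV2 ?posrE ?exprn_gt0 // -ler_ln ?posrE ?exprn_gt0 //.
rewrite lnM ?posrE ?exprn_gt0 // !lnXn //.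
rewrite -[leRHS]mulr_natl -[ln x *+ 2]mulr_natl.
rewrite -ler_pdivrMr //; apply: le_trans tge.
by rewrite /logb mulrDl mulrA.
Qed.

Theorem theorem7p1 (R : realType) (G : finGroupType)
    (* (T, P) carries W, P_0 and the E_i; (S, Q) carries the choice of the g_i *)
    (d : measure_display) (T : measurableType d) (P : probability T R)
    (d' : measure_display) (S : measurableType d') (Q : probability S R)
    (alpha : R) (W P0 : {RV P >-> discr G}) (E : nat -> {RV P >-> bool})
    (g : nat -> {RV Q >-> discr G}) (lambda : R) (t : nat) :
  0 <= alpha -> alpha < 1 -> semi_uniform P alpha W ->
  (forall i b, Pr P (E i @^-1` [set b]) = 1 / 2) ->
  mutually_independent P (fun o : option nat =>
    if o is Some i then g_sigma_algebra_preimage (E i)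
    else g_sigma_algebra_preimage P0) ->
  (forall i, same_distribution Q P (g i) W) ->
  mutually_independent Q (fun i => g_sigma_algebra_preimage (g i)) ->
  1 < lambda ->
  let gamma := 14 / (11 + 3 * alpha) in
  2 * logb gamma #|G|%:R + logb gamma (64 * lambda) <= t%:R ->
  let Pt (s : S) : {RV P >-> discr G} := walk P0 E (fun i => g i s) t in
  1 - 1 / lambda <=
    Pr Q [set s | forall x : G,
                    Pr P (Pt s @^-1` [set x]) <= 15 / 8 * (1 / #|G|%:R)]
  /\
  ((forall h : nat -> G, independent_RV P W (walk P0 E h t)) ->
   1 - 1 / lambda <=
     Pr Q [set s | eps_uniform P (Num.max alpha (7 / 8)) (mul_RV W (Pt s))]).
Proof.
move=> a0 a1 semiW E12 indE gW indg lambda1 gamma tge Pt.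
have n0 : 0 < #|G|%:R :> R by rewrite lt0r cardG_neq0 ler0n.
have gE i (x : G) : Pr Q (g i @^-1` [set x]) = Pr P (W @^-1` [set x]).
  by congr fine; exact: (gW i).
pose w (a : G) := Pr P (W @^-1` [set a]).
have wge (a : G) : (1 - alpha) / #|G|%:R <= w a.
  by have := semiW a; rewrite mulrBl.
have w1 : \sum_a w a = 1 by exact: sum_Pr_fiber.
pose bad : set (nat -> G) := [set h | exists x : G,
  15 / 8 * (1 / #|G|%:R) < Pr P (walk P0 E h t @^-1` [set x])].
have bad_t : determined_before t bad.
  by move=> h h' hh' [x]; rewrite (walk_fiber_ext P0 E _ hh') => ?; exists x.
(* As 15/8 - 1 = 7/8, a bad history has a deviation above 7/8 / |G|, hence energy at least [c]. *)
pose c : R := (7 / 8 * (1 / #|G|%:R)) ^+ 2.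
have c0 : 0 < c by rewrite exprn_gt0 // !mulr_gt0 ?invr_gt0.
(* The energy at time [k], multiplied in advance by the contraction of the remaining steps and
   normalised so that bad histories have [V t h >= 1]. *)
pose V k h := ((1 + alpha) / 2) ^+ (t - k) * energy P0 E h k / c.
have Qbad : Pr Q [set s | bad (fun i => g i s)] <= 1 / lambda.
  (* The history is arbitrary here: at time 0 no step has been taken. *)
  apply: (@le_trans _ _ (V 0%N (fun=> 1%g))).
    apply: (@Pr_le_supermartingale _ _ _ Q G g w V t bad) => //.
    - by move=> h k; rewrite Pr_cylinder //; apply: eq_bigr => i _; exact: gE.
    - move=> h k; rewrite !mulr_ge0 ?invr_ge0 ?energy_ge0 ?(ltW c0) //.
      by rewrite exprn_ge0 //; lra.
    - move=> h k kt; rewrite /V -(subnSK kt) exprSr.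
      set r := _ ^+ (t - k.+1).
      have r0 : 0 <= r / c by rewrite divr_ge0 ?(ltW c0) // exprn_ge0 //; lra.
      rewrite [leLHS](_ : _ = r / c *
          \sum_x w x * energy P0 E (update h k x) k.+1); last first.
        by rewrite mulr_sumr; apply: eq_bigr => x _; ring.
      rewrite [leRHS](_ : _ = r / c * ((1 + alpha) / 2 * energy P0 E h k));
        last ring.
      by rewrite ler_wpM2l // energy_step.
    - move=> h [x xlt]; rewrite /V subnn expr0 mul1r ler_pdivlMr // mul1r.
      rewrite /energy (bigD1 x) //=; apply: ler_wpDr.
        by apply: sumr_ge0 => y _; exact: sqr_ge0.
      have u0 : 0 < 1 / #|G|%:R :> R by rewrite divr_gt0.
      by rewrite lerXn2r ?nnegrE; lra.
  have lambda0 : 0 < lambda by exact: lt_trans lambda1.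
  have c64 : 0 < 64 * lambda by rewrite mulr_gt0.
  have rle := contraction_pow_le a0 a1 c64 n0 tge.
  rewrite /V subn0 ler_pdivrMr //.
  have e1 := energy0_le1 P0 E (fun=> 1%g).
  apply: (@le_trans _ _ (((1 + alpha) / 2) ^+ t)).
    by rewrite ler_piMr // exprn_ge0 //; lra.
  apply: le_trans rle _.
  (* The constant 64 leaves room: 1/64 <= 49/64 = (7/8)^2. *)
  rewrite [leLHS](_ : _ =
      1 / lambda * ((1 / 64) * (1 / #|G|%:R) ^+ 2)); last first.
    by field; rewrite !gt_eqF.
  rewrite ler_wpM2l ?divr_ge0 ?(ltW lambda0) // /c [leRHS]exprMn.
  by rewrite ler_wpM2r ?sqr_ge0 //; lra.
have good s : ~ bad (fun i => g i s) -> forall x : G,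
    Pr P (Pt s @^-1` [set x]) <= 15 / 8 * (1 / #|G|%:R).
  by move=> nbad x; rewrite leNgt; apply/negP => xlt; apply: nbad; exists x.
have mbad : measurable [set s | bad (fun i => g i s)].
  exact: (measurable_determined g bad_t).
have likely (A : set S) : measurable A ->
    ~` [set s | bad (fun i => g i s)] `<=` A -> 1 - 1 / lambda <= Pr Q A.
  move=> mA gA; apply: (@le_trans _ _
      (Pr Q (~` [set s | bad (fun i => g i s)]))).
    by rewrite Pr_setC // lerB.
  by apply: le_Pr => //; exact: measurableC.
split.
  apply: likely => //.
  pose B : set (nat -> G) := [set h | forall x : G,
    Pr P (walk P0 E h t @^-1` [set x]) <= 15 / 8 * (1 / #|G|%:R)].
  apply: (measurable_determined g (B := B) (t := t)) => h h' hh' Bh x.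
  by rewrite -(walk_fiber_ext P0 E _ hh').
move=> indW; apply: likely; last first.
  move=> s /good Ps; apply: (mul_RV_eps_uniform semiW (indW _)) => x.
  by apply: le_trans (Ps x) _; lra.
pose B : set (nat -> G) := [set h |
  eps_uniform P (Num.max alpha (7 / 8)) (mul_RV W (walk P0 E h t))].
apply: (measurable_determined g (B := B) (t := t)) => h h' hh' Bh x.
have := Bh x; congr (`|Pr P _ - _| <= _); apply/seteqP; split=> v;
  by rewrite /= /mul_RV (walk_ext P0 E hh').
Qed.
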